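(* Let $\delta\in(0,1)$ and let $\bar\rho\ge 2$ be a fixed real number. There is a constant $C>0$ (depending only on $\delta$ and on the bound $\bar\rho$) such that the following holds. Let $G=(V,E)$ be a graph on $n$ vertices whose adjacency matrix has spectral radius $\rho_G$ with $2\le\rho_G\le\bar\rho$, and let $\mu_G$ be the zero external field Ising model on $G$ with parameter $\beta$ satisfying $$\frac{\rho_G-1+\delta}{\rho_G+1-\delta}\ \le\ \beta\ \le\ \frac{\rho_G+1-\delta}{\rho_G-1+\delta}.$$ Then the mixing time of the Glauber dynamics on $\mu_G$ is at most $C\,n\log n$.
   Context: All graphs are finite, undirected, simple and connected. The adjacency matrix $\mathbf A_G$ is the $V\times V$ $0/1$ matrix with $\mathbf A_G(u,w)=1$ iff $u,w$ are adjacent; its spectral radius is the maximum modulus of its eigenvalues. The zero external field Ising model with parameter $\beta>0$ is the distribution on $\{\pm1\}^V$ with $\mu_G(\sigma)\propto \beta^{\#\{\{x,y\}\in E:\ \sigma(x)=\sigma(y)\}}$. Glauber dynamics for a distribution $\mu$ on $\{\pm1\}^V$: the discrete-time Markov chain $(X_t)_{t\ge0}$ on the support of $\mu$ which, given $X_t$, picks a vertex $v$ uniformly at random, sets $X_{t+1}(w)=X_t(w)$ for all $w\ne v$, and samples $X_{t+1}(v)$ from the marginal of $\mu$ at $v$ conditional on the configuration $X_{t+1}$ on the neighbours of $v$. With transition matrix $P$ and stationary distribution $\mu$, the mixing time is $T_{\rm mix}=\min\{t\ge0:\ \|P^t(\sigma,\cdot)-\mu\|_{tv}\le 1/4\ \text{for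 all }\sigma\}$, where $\|\nu-\hat\nu\|_{tv}=\frac12\sum_x|\nu(x)-\hat\nu(x)|$. *)

(* Defs.v *)
From HB Require Import structures.
From mathcomp Require Import all_boot all_order all_algebra.
From mathcomp Require Import complex.
From mathcomp Require Import boolp classical_sets reals ereal exp.

Set Implicit Arguments.
Unset Strict Implicit.
Unset Printing Implicit Defensive.

Import Order.TTheory GRing.Theory Num.Theory.

Local Open Scope ring_scope.
Local Open Scope complex_scope.

Definition connected_simple_graph (V : finType) (e : rel V) : Prop :=
  [/\ symmetric e, irreflexive e & forall x y : V, connect e x y].

(* Matrices indexed by a finite type T, through the enumeration of T. *)
Definition fin_mx (R : realType) (T : finType) (f : T -> T -> R) : 'M[R]_#|T| :=
  \matrix_(i, j) f (enum_val i) (enum_val j).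

Definition adjacency_mx (R : realType) (V : finType) (e : rel V) :
    'M[R]_#|V| :=
  fin_mx (fun u w => (e u w)%:R).

(* Complex eigenvalues of a real matrix. Their set is finite, so the supremum
   is a maximum, except for the empty matrix, whose spectral radius is 0. *)
Definition spectral_radius (R : realType) (n : nat) (A : 'M[R]_n) : R :=
  sup [set ComplexField.Normc.normc a
      | a in [set a : R[i] | eigenvalue (map_mx (real_complex R) A) a]]%classic.

(* true encodes the spin +1 and false the spin -1. *)
Definition config (V : finType) := {ffun V -> bool}.

(* An edge is the unordered pair [set p.1; p.2], so each edge is counted once. *)
Definition monochromatic_edges (V : finType) (e : rel V) (s : config V) :
    {set {set V}} :=
  (fun p : V * V => [set p.1; p.2]) @:
    [set p : V * V | e p.1 p.2 && (s p.1 == s p.2)].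

Definition ising_weight (R : realType) (V : finType) (e : rel V) (beta : R)
    (s : config V) : R :=
  beta ^+ #|monochromatic_edges e s|.

Definition ising (R : realType) (V : finType) (e : rel V) (beta : R)
    (s : config V) : R :=
  ising_weight e beta s / \sum_(t : config V) ising_weight e beta t.

Definition agree_on_nbrs (V : finType) (e : rel V) (v : V) (s t : config V) :
    bool :=
  [forall w, e v w ==> (t w == s w)].

Definition agree_off (V : finType) (v : V) (s t : config V) : bool :=
  [forall w, (w != v) ==> (t w == s w)].

(* The mu-probability that v has spin b, conditional on the neighbours of v
   having the same spins as in s. *)
Definition cond_marginal (R : realType) (V : finType) (e : rel V)
    (mu : config V -> R) (v : V) (s : config V) (b : bool) : R :=
  (\sum_(t | agree_on_nbrs e v s t && (t v == b)) mu t) /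
  (\sum_(t | agree_on_nbrs e v s t) mu t).

Definition glauber (R : realType) (V : finType) (e : rel V)
    (mu : config V -> R) (s t : config V) : R :=
  \sum_(v : V) #|V|%:R^-1 *
    (if agree_off v s t then cond_marginal e mu v s (t v) else 0).

Definition tv_dist (R : realType) (T : finType) (nu nu' : T -> R) : R :=
  2^-1 * \sum_(x : T) `|nu x - nu' x|.

Definition mc_law (R : realType) (T : finType) (P : T -> T -> R) (t : nat)
    (x y : T) : R :=
  (fin_mx P ^+ t) (enum_rank x) (enum_rank y).

(* The state space is the support of mu, hence the restriction on the initial
   state x. *)
Definition mixed_at (R : realType) (T : finType) (P : T -> T -> R)
    (mu : T -> R) (t : nat) : Prop :=
  forall x : T, 0 < mu x -> tv_dist (mc_law P t x) mu <= 4^-1.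

(* The least t such that mixed_at P mu t, or +oo if there is none. *)
Definition mixing_time (R : realType) (T : finType) (P : T -> T -> R)
    (mu : T -> R) : \bar R :=
  ereal_inf [set (t%:R)%:E | t in [set t : nat | mixed_at P mu t]]%classic.

(* Main.v *)
Require Import Defs.
From HB Require Import structures.
From mathcomp Require Import all_boot all_order all_algebra.
From mathcomp Require Import complex ring lra.
From mathcomp Require Import boolp classical_sets reals ereal sequences exp.

Import Order.TTheory GRing.Theory Num.Theory.
Local Open Scope ring_scope.

(** The proof is Dobrushin's argument, run in the Euclidean norm.  It tracks the
oscillation of a function f of the configuration at each vertex w: a bound d w
on the change of f when the spin at w alone is flipped.

Resampling the spin at v removes the dependence of f on v.  In exchange,
flipping a neighbour w of v moves the conditional law at v, by at most
a = |beta - 1| / (beta + 1) in total variation ([cond_marginal_flip]), which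
adds at most a * d v to the oscillation at w.  Averaging over v, one step of the
dynamics replaces d by M d with M = (1 - 1/n) I + (a/n) A, where A is the
adjacency matrix ([glauber_op_osc]).

The matrix A is symmetric, so by the spectral theorem its Euclidean operator
norm is at most its spectral radius rho ([symmetric_mulmx_le]).  The interval
allowed for beta says exactly that a * rho <= 1 - delta, so M contracts the
Euclidean norm by the factor 1 - delta / n ([influence_step_l2]).

Let P be the transition matrix.  Twice the distance between the law at time t
started from s and mu is the value of P^t f - mu(f) at s, where f is the sign of
the difference of the two laws.  As mu is stationary, this compares P^t f at s
with its own mu-mean, so it is at most the sum of the oscillations of P^t f
([tv_dist_glauber_le]).  They start from 2 at each vertex; by Cauchy-Schwarz,
their sum at time t is at most 2 n (1 - delta / n)^t.  Hence
t >= (n / delta) ln (4 n) suffices, and this is O(n ln n) because n >= 2, a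
single vertex having spectral radius 0. *)

(** * The spectral radius bounds the Euclidean norm of a symmetric matrix *)

Section Spectral.
Local Open Scope sesquilinear_scope.

Definition sqnorm {C : numClosedFieldType} {n} (z : 'rV[C]_n) : C :=
  (z *m z^t*) 0 0.

Lemma sqnormE (C : numClosedFieldType) n (z : 'rV[C]_n) :
  sqnorm z = \sum_j `|z 0 j| ^+ 2.
Proof.
by rewrite /sqnorm mxE; apply: eq_bigr => j _; rewrite !mxE normCK.
Qed.

Lemma sqnorm_unitary {C : numClosedFieldType} {n} (z : 'rV[C]_n) (U : 'M[C]_n) :
  U \is unitarymx -> sqnorm (z *m U) = sqnorm z.
Proof.
move=> Uu; rewrite /sqnorm trmx_mul map_mxM mulmxA.
by rewrite mulmxtVK.
Qed.

(** The spectral radius is a supremum, so the moduli of the eigenvalues must be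
bounded: the sum of the moduli of the roots of the characteristic polynomial is
a bound. *)
Lemma normC_le_spectral_radius {R : realType} {n} (A : 'M[R]_n) (a : R[i]) :
  eigenvalue (map_mx (real_complex R) A) a ->
  `|a| <= (real_complex R (spectral_radius A)).
Proof.
move=> Aa.
rewrite [`|a|](_ : _ = real_complex R (ComplexField.Normc.normc a))//.
rewrite lecR; apply: ub_le_sup; last by exists a.
have [rs rsE] :=
  closed_field_poly_normal (char_poly (map_mx (real_complex R) A)).
exists (\sum_(r <- rs) ComplexField.Normc.normc r) => _ [b /= Ab <-].
move: Ab; rewrite eigenvalue_root_char rsE.
rewrite (monicP (char_poly_monic _)) scale1r root_prod_XsubC => brs.
rewrite (big_rem b)//= lerDl; apply: sumr_ge0 => r _.
by rewrite -lecR; exact: (normr_ge0 r).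
Qed.

(** Over the complex numbers A = U^-1 D U with U unitary and D diagonal.
Unitary matrices preserve the norm, and D multiplies each coordinate by an
eigenvalue. *)
Lemma symmetric_mulmx_le {R : realType} {n} (A : 'M[R]_n) (x : 'rV[R]_n) :
  A^T = A ->
  \sum_j ((x *m A) 0 j) ^+ 2 <= spectral_radius A ^+ 2 * \sum_j (x 0 j) ^+ 2.
Proof.
move=> symA; pose rc := real_complex R; pose B := map_mx rc A.
pose rho := spectral_radius A.
have BB : B \is hermsymmx.
  apply: realsym_hermsym.
    apply/is_hermitianmxP.
    by rewrite expr0 scale1r map_mx_id// /B map_trmx symA.
  by apply/mxOverP => i j; rewrite mxE complex_real.
have /orthomx_spectralP := hermitian_normalmx BB.
set U := spectralmx B; set D := spectral_diag B => BE.
have Uu : U \is unitarymx := spectral_unitarymx B.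
(* Row i of U is an eigenvector, nonzero because the rows are orthonormal. *)
have dle i : `|D 0 i| <= rc rho.
  apply: normC_le_spectral_radius.
  have UB : U *m B = diag_mx D *m U.
    by rewrite BE !mulmxA mulmxV ?spectral_unit// mul1mx.
  apply/eigenvalueP; exists (row i U).
    rewrite -row_mul UB mul_diag_mx; apply/rowP => j; rewrite !mxE//.
  apply/eqP => Ui0.
  have /row_unitarymxP/(_ i i) := Uu.
  by rewrite Ui0 eqxx linear0l => /eqP; rewrite eq_sym oner_eq0.
have key : sqnorm (map_mx rc x *m B) <= rc rho ^+ 2 * sqnorm (map_mx rc x).
  rewrite BE invmx_unitary// mulmxA sqnorm_unitary// mulmxA.
  rewrite -[in leRHS](sqnorm_unitary (map_mx rc x) (U^t*)) ?trmxC_unitary//.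
  set y := _ *m U^t*; rewrite !sqnormE mulr_sumr.
  apply: ler_sum => j _; rewrite mul_mx_diag mxE normrM exprMn mulrC.
  by rewrite ler_wpM2r ?exprn_ge0// lerXn2r ?nnegrE//; exact: le_trans (dle j).
have sqn (z : 'rV[R]_n) : sqnorm (map_mx rc z) = rc (\sum_j (z 0 j) ^+ 2).
  rewrite sqnormE /rc rmorph_sum; apply: eq_bigr => j _.
  by rewrite mxE real_normK ?complex_real// -rmorphXn.
by move: key; rewrite -map_mxM !sqn /rc -rmorphXn -rmorphM lecR.
Qed.

End Spectral.

(** * Single-spin updates *)

Definition upd {V : finType} (s : config V) (v : V) (b : bool) : config V :=
  [ffun w => if w == v then b else s w].

Definition flip {V : finType} (s : config V) (v : V) : config V :=
  upd s v (~~ s v).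

Section Updates.
Context {V : finType}.
Implicit Types (s t : config V) (v w : V) (b : bool).

Lemma updE s v b w : upd s v b w = if w == v then b else s w.
Proof. by rewrite ffunE. Qed.

Lemma upd_id s v : upd s v (s v) = s.
Proof. by apply/ffunP => w; rewrite updE; case: eqP => // ->. Qed.

Lemma upd_upd s v b c : upd (upd s v b) v c = upd s v c.
Proof. by apply/ffunP => w; rewrite !updE; case: eqP. Qed.

Lemma upd_flip s v b : upd (flip s v) v b = upd s v b.
Proof. exact: upd_upd. Qed.

Lemma upd_flip_comm s v w b : w != v -> upd (flip s w) v b = flip (upd s v b) w.
Proof.
move=> wv; apply/ffunP => u; rewrite !updE (negbTE wv).
by case: (u =P v) => // ->; rewrite eq_sym (negbTE wv).
Qed.

Lemma flipK v : involutive (flip ^~ v).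
Proof.
by move=> s; apply/ffunP => w; rewrite !updE eqxx negbK; case: eqP => // ->.
Qed.

Lemma sum_upd {R : nmodType} (F : config V -> R) s v :
  \sum_b F (upd s v b) = F s + F (flip s v).
Proof.
rewrite big_bool /= /flip; have := upd_id s v.
by case: (s v) => -> //=; rewrite addrC.
Qed.

Lemma sum_agree_off {R : nmodType} (F : config V -> R) s v :
  \sum_(t | agree_off v s t) F t = \sum_b F (upd s v b).
Proof.
rewrite (partition_big (fun t : config V => t v) predT)//=.
apply: eq_bigr => b _; apply: big_pred1 => t /=.
apply/andP/eqP => [[/forallP st /eqP tv]|->].
  apply/ffunP => w; rewrite updE; case: eqP => [->//|/eqP wv].
  by have /implyP/(_ wv)/eqP := st w.
split; last by rewrite updE eqxx.
by apply/forallP => w; apply/implyP => wv; rewrite updE (negbTE wv).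
Qed.

End Updates.

(** * The conditional marginals of the Ising model *)

Definition nbrs_with_spin {V : finType} (e : rel V) (v : V) (s : config V)
    (b : bool) : nat := #|[set w | e v w & s w == b]|.

(** The part of the energy that resampling v leaves unchanged. *)
Definition mono_edges_off {V : finType} (e : rel V) (v : V) (s : config V) :
  nat := #|[set E in monochromatic_edges e s | v \notin E]|.

(** This is the modulus of tanh (ln beta / 2), the largest influence of one
endpoint of an edge on the conditional law at the other. *)
Definition edge_influence {R : realType} (beta : R) : R :=
  `|beta - 1| / (beta + 1).

Section Marginals.
Context {V : finType} {e : rel V}.
Hypotheses (e_sym : symmetric e) (e_irr : irreflexive e).
Implicit Types (s t : config V) (v w : V) (b : bool).

Lemma card_monochromatic_edges v s :
  #|monochromatic_edges e s| =
  (nbrs_with_spin e v s (s v) + mono_edges_off e v s)%N.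
Proof.
rewrite /mono_edges_off -(cardsID [set E : {set V} | v \in E]); congr (_ + _)%N.
  rewrite /nbrs_with_spin -(card_imset (f := fun w => [set v; w])).
    apply: eq_card => E; rewrite !inE; apply/andP/imsetP.
      case=> /imsetP[[x y]]; rewrite !inE /= => /andP[exy /eqP sxy] -> /=.
      rewrite !inE => /orP[]/eqP->.
        by exists y => //; rewrite inE exy sxy /=.
      exists x; first by rewrite inE e_sym exy sxy eqxx.
      by rewrite finset.setUC.
    case=> w; rewrite inE => /andP[evw /eqP sw] ->.
    split; last by rewrite !inE eqxx.
    by apply/imsetP; exists (v, w) => //; rewrite inE /= evw sw /=.
  move=> w w' vww'; have := set22 v w; rewrite vww' !inE.
  case/orP=> /eqP // wv; have := set22 v w'.
  by rewrite -vww' wv !inE orbb => /eqP.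
by apply: eq_card => E; rewrite !inE andbC.
Qed.

Lemma nbrs_with_spin_upd v s b c :
  nbrs_with_spin e v (upd s v b) c = nbrs_with_spin e v s c.
Proof.
apply: eq_card => w; rewrite !inE updE.
by case: (w =P v) => [->|//]; rewrite e_irr.
Qed.

Lemma mono_edges_off_upd v s b :
  mono_edges_off e v (upd s v b) = mono_edges_off e v s.
Proof.
apply: eq_card => E; rewrite !inE; apply/andP/andP => -[/imsetP[[x y]]];
  rewrite !inE /= => + -> /=; rewrite !inE negb_or => H /andP[vx vy];
  (split; last by rewrite vx vy); apply/imsetP; exists (x, y) => //;
  by move: H; rewrite !inE /= !updE ![_ == v]eq_sym (negbTE vx) (negbTE vy).
Qed.

Lemma agree_on_nbrs_flip v s t :
  agree_on_nbrs e v s (flip t v) = agree_on_nbrs e v s t.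
Proof.
apply: eq_forallb => w; rewrite updE.
by case: (w =P v) => [->|//]; rewrite e_irr.
Qed.

Lemma nbrs_with_spin_agree v s t b : agree_on_nbrs e v s t ->
  nbrs_with_spin e v t b = nbrs_with_spin e v s b.
Proof.
move=> /forallP st; apply: eq_card => w; rewrite !inE.
by case evw: (e v w) => //=; have := st w; rewrite evw => /eqP ->.
Qed.

Lemma nbrs_with_spin_flip v w s : e v w ->
  nbrs_with_spin e v s (s w) = (nbrs_with_spin e v (flip s w) (s w)).+1.
Proof.
move=> evw; rewrite /nbrs_with_spin (cardsD1 w) inE evw eqxx add1n; congr _.+1.
apply: eq_card => u; rewrite !inE updE.
by case: (u =P w) => [->|//]; rewrite evw /=; case: (s w).
Qed.

Lemma nbrs_with_spin_flip_notin v w s b : ~~ e v w ->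
  nbrs_with_spin e v (flip s w) b = nbrs_with_spin e v s b.
Proof.
move=> evw; apply: eq_card => u; rewrite !inE updE.
by case: (u =P w) => [->|//]; rewrite (negbTE evw).
Qed.

Context {R : realType} {beta : R}.
Hypothesis beta_gt0 : 0 < beta.

Local Notation mu := (ising e beta).
Local Notation Z := (\sum_(t : config V) ising_weight e beta t).

Lemma ising_weight_gt0 s : 0 < ising_weight e beta s.
Proof. exact: exprn_gt0. Qed.

Lemma ising_partition_gt0 : 0 < Z.
Proof.
rewrite (bigD1 [ffun=> true])//= ltr_pwDl ?ising_weight_gt0//.
by apply: sumr_ge0 => t _; apply/ltW/ising_weight_gt0.
Qed.

Lemma ising_gt0 s : 0 < mu s.
Proof. by rewrite divr_gt0 ?ising_weight_gt0// ising_partition_gt0. Qed.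

Lemma sum_ising : \sum_s mu s = 1.
Proof. by rewrite -mulr_suml mulfV// gt_eqF// ising_partition_gt0. Qed.

Lemma ising_split v s :
  mu s = beta ^+ nbrs_with_spin e v s (s v)
         * (beta ^+ mono_edges_off e v s / Z).
Proof. by rewrite mulrA -exprD -card_monochromatic_edges. Qed.

Lemma ising_upd v s b :
  mu (upd s v b) =
  beta ^+ nbrs_with_spin e v s b * (beta ^+ mono_edges_off e v s / Z).
Proof.
by rewrite (ising_split v) updE eqxx nbrs_with_spin_upd mono_edges_off_upd.
Qed.

(** The weight of a configuration factors: the edges at v depend only on the
spin at v and on the spins of its neighbours, which are fixed, and the product
over the other edges has the same sum whichever spin v carries: it cancels. *)
Lemma cond_marginal_ising v s b :
  cond_marginal e mu v s b =
  beta ^+ nbrs_with_spin e v s b /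
  (beta ^+ nbrs_with_spin e v s true + beta ^+ nbrs_with_spin e v s false).
Proof.
pose S c := \sum_(t | agree_on_nbrs e v s t && (t v == c))
  beta ^+ mono_edges_off e v t / Z.
have numE c : \sum_(t | agree_on_nbrs e v s t && (t v == c)) mu t =
    beta ^+ nbrs_with_spin e v s c * S c.
  rewrite mulr_sumr; apply: eq_bigr => t /andP[st /eqP tv].
  by rewrite (ising_split v) tv (nbrs_with_spin_agree _ _ _ _ st).
have S_flip c : S c = S true.
  case: c => //; rewrite /S (reindex_inj (inv_inj (flipK v))).
  apply: eq_big => t; last by rewrite mono_edges_off_upd.
  by rewrite agree_on_nbrs_flip updE eqxx; case: (t v).
have S_neq0 : S true != 0.
  rewrite gt_eqF// /S (bigD1 (upd s v true)) /=.
    rewrite ltr_pwDl ?divr_gt0 ?exprn_gt0 ?ising_partition_gt0//.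
    apply: sumr_ge0 => t _.
    by rewrite divr_ge0 ?exprn_ge0 ?ltW// ising_partition_gt0.
  rewrite updE !eqxx andbT; apply/forallP => w; apply/implyP => evw.
  by rewrite updE; case: (w =P v) evw => [->|//]; rewrite e_irr.
rewrite /cond_marginal numE.
rewrite (partition_big (fun t : config V => t v) predT)//= big_bool /=.
rewrite !numE (S_flip b) (S_flip false) -mulrDl -mulf_div mulfV ?mulr1//.
Qed.

Lemma cond_marginal_upd v s b c :
  cond_marginal e mu v (upd s v b) c = cond_marginal e mu v s c.
Proof. by rewrite !cond_marginal_ising !nbrs_with_spin_upd. Qed.

Lemma cond_marginal_ge0 v s b : 0 <= cond_marginal e mu v s b.
Proof. by rewrite cond_marginal_ising divr_ge0 ?addr_ge0 ?exprn_ge0 ?ltW. Qed.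

Lemma cond_marginal_sum v s :
  cond_marginal e mu v s true + cond_marginal e mu v s false = 1.
Proof.
by rewrite !cond_marginal_ising -mulrDl mulfV// gt_eqF// addr_gt0 ?exprn_gt0.
Qed.

(** Conditioning on the neighbours of v is the same as conditioning on all the
spins off v (Markov property).  This is what makes mu stationary. *)
Lemma cond_marginal_balance v s b :
  cond_marginal e mu v s b * \sum_c mu (upd s v c) = mu (upd s v b).
Proof.
rewrite big_bool /= !ising_upd cond_marginal_ising -mulrDl mulrA divfK//.
by rewrite gt_eqF// addr_gt0 ?exprn_gt0.
Qed.

(** The two ratios are the probabilities of spin + at v before and after one
neighbour is flipped, with x and y the weights contributed by the other
neighbours.  The difference is greatest for x = y, and the defect is a multiple
of (x - y)^2. *)
Lemma ratio_shift_le (x y : R) : 0 < x -> 0 < y ->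
  `|beta * x / (beta * x + y) - x / (x + beta * y)| <= edge_influence beta.
Proof.
move=> x0 y0; have bx := mulr_gt0 beta_gt0 x0; have bY := mulr_gt0 beta_gt0 y0.
have D0 : 0 < (beta * x + y) * (x + beta * y) by rewrite mulr_gt0// addr_gt0.
have -> : beta * x / (beta * x + y) - x / (x + beta * y) =
    (beta - 1) * (((beta + 1) * (x * y)) / ((beta * x + y) * (x + beta * y))).
  by field; rewrite !gt_eqF// addr_gt0.
rewrite normrM ler_wpM2l// ger0_norm; last first.
  by rewrite divr_ge0 ?mulr_ge0 ?addr_ge0 ?ltW.
rewrite ler_pdivrMr// ler_pdivlMl ?addr_gt0//.
rewrite -subr_ge0 (_ : _ - _ = beta * (x - y) ^+ 2); last by ring.
by rewrite mulr_ge0 ?sqr_ge0 ?ltW.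
Qed.

Lemma cond_marginal_flip v w s :
  `|cond_marginal e mu v (flip s w) true - cond_marginal e mu v s true|
    <= (e v w)%:R * edge_influence beta.
Proof.
case evw: (e v w); last first.
  rewrite !cond_marginal_ising !nbrs_with_spin_flip_notin ?evw//.
  by rewrite subrr normr0 mul0r.
(* Flipping w exchanges the two cases, so w may be assumed to have spin +. *)
rewrite mul1r; wlog sw : s / s w.
  move=> H; case sw: (s w); first exact: H.
  have := H (flip s w); rewrite flipK distrC; apply.
  by rewrite updE eqxx sw.
have Et := nbrs_with_spin_flip v w s evw.
have Ef := nbrs_with_spin_flip v w (flip s w) evw.
rewrite flipK updE eqxx sw in Ef; rewrite sw in Et.
rewrite distrC !cond_marginal_ising Et Ef !exprS.
by apply: ratio_shift_le; rewrite exprn_gt0.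
Qed.

End Marginals.

(** * Oscillations *)

(** A bound d, rather than the exact oscillation, spares taking maxima, and
such bounds propagate linearly under the dynamics. *)
Definition osc_le {R : realType} {V : finType} (f : config V -> R)
    (d : V -> R) : Prop :=
  forall s w, `|f (flip s w) - f s| <= d w.

Section Oscillation.
Context {R : realType} {V : finType} {f : config V -> R} {d : V -> R}.
Hypothesis fd : osc_le f d.

Lemma osc_le_ge0 w : 0 <= d w.
Proof. exact: le_trans (fd [ffun=> true] w). Qed.

(** Pass from s to t by changing the spins one vertex at a time. *)
Lemma osc_le_dist (s t : config V) : `|f t - f s| <= \sum_w d w.
Proof.
pose mix (r : seq V) : config V := [ffun w => if w \in r then t w else s w].
have mixP r : `|f (mix r) - f s| <= \sum_(w <- r) d w.
  elim: r => [|w r IHr].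
    rewrite (_ : mix [::] = s) ?subrr ?normr0 ?big_nil//.
    by apply/ffunP => w; rewrite ffunE.
  have -> : mix (w :: r) = upd (mix r) w (t w).
    by apply/ffunP => u; rewrite updE !ffunE inE; case: (u =P w) => [->|].
  rewrite big_cons -[_ - f s](subrKA (f (mix r))) (le_trans (ler_normD _ _))//.
  apply: lerD => //; have [->|ne] := eqVneq (t w) (mix r w).
    by rewrite upd_id subrr normr0 osc_le_ge0.
  have -> : t w = ~~ mix r w by move: ne; case: (t w); case: (mix r w).
  exact: fd.
have := mixP (enum V); rewrite big_enum /=.
rewrite (_ : mix _ = t)//.
by apply/ffunP => w; rewrite ffunE mem_enum.
Qed.

Lemma osc_le_mean (mu : config V -> R) (s : config V) :
  (forall t, 0 <= mu t) -> \sum_t mu t = 1 ->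
  `|f s - \sum_t mu t * f t| <= \sum_w d w.
Proof.
move=> mu_ge0 mu1; rewrite -[f s]mul1r -mu1 mulr_suml -sumrB.
rewrite (le_trans (ler_norm_sum _ _ _))// -[leRHS]mul1r -mu1 mulr_suml.
apply: ler_sum => t _; rewrite -mulrBr normrM ger0_norm//.
by rewrite ler_wpM2l// osc_le_dist.
Qed.

End Oscillation.

(** * One step of the dynamics *)

Section Glauber.
Context {R : realType} {V : finType} {e : rel V} {beta : R}.
Hypotheses (e_sym : symmetric e) (e_irr : irreflexive e).
Hypothesis beta_gt0 : 0 < beta.

Local Notation mu := (ising e beta).
Local Notation cm := (cond_marginal e mu).

Definition glauber_op (f : config V -> R) (s : config V) : R :=
  \sum_t glauber e mu s t * f t.

Definition site_op (v : V) (f : config V -> R) (s : config V) : R :=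
  \sum_b cm v s b * f (upd s v b).

Definition influence_step (d : V -> R) (w : V) : R :=
  #|V|%:R^-1 * ((#|V|%:R - 1) * d w
                + edge_influence beta * \sum_v (e w v)%:R * d v).

Lemma glauber_opE f s : glauber_op f s = #|V|%:R^-1 * \sum_v site_op v f s.
Proof.
rewrite /glauber_op; under eq_bigr do rewrite mulr_suml.
rewrite exchange_big mulr_sumr; apply: eq_bigr => v _ /=.
under eq_bigr do rewrite -mulrA; rewrite -mulr_sumr; congr (_ * _).
transitivity (\sum_(t | agree_off v s t) cm v s (t v) * f t).
  by rewrite [RHS]big_mkcond; apply: eq_bigr => t _; case: ifP; rewrite ?mul0r.
rewrite sum_agree_off; apply: eq_bigr => b _.
by rewrite updE eqxx.
Qed.

(** At w <> v the difference splits into the change of f with the law at v kept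
fixed, at most d w, and the change of the law at v, which costs its total
variation times the oscillation of f at v.  At w = v the resampling forgets the
flipped spin. *)
Lemma site_op_osc v f d s w : osc_le f d ->
  `|site_op v f (flip s w) - site_op v f s|
    <= (w != v)%:R * d w + edge_influence beta * ((e w v)%:R * d v).
Proof.
move=> fd; have [->|wv] := eqVneq w v.
  rewrite e_irr !mul0r mulr0 addr0 /site_op.
  under eq_bigr do rewrite upd_flip cond_marginal_upd//.
  by rewrite subrr normr0.
rewrite mul1r; pose p := cm v s true; pose p' := cm v (flip s w) true.
pose f' b := f (upd s v b); pose g' b := f (flip (upd s v b) w).
have q : cm v s false = 1 - p.
  by rewrite -(cond_marginal_sum e_sym e_irr beta_gt0 v s) addrC addKr.
have q' : cm v (flip s w) false = 1 - p'.
  by rewrite -(cond_marginal_sum e_sym e_irr beta_gt0 v (flip s w)) addrC addKr.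
have p'0 : 0 <= p' by exact: cond_marginal_ge0.
have p'1 : 0 <= 1 - p' by rewrite -q' cond_marginal_ge0.
rewrite /site_op !big_bool /= !upd_flip_comm// q q'.
rewrite -/p -/p' -!/(f' _) -!/(g' _).
rewrite (_ : _ - _ = (p' * (g' true - f' true) + (1 - p') * (g' false - f' false))
                    + (p' - p) * (f' true - f' false)); last by ring.
apply: le_trans (ler_normD _ _) _; apply: lerD.
  apply: le_trans (ler_normD _ _) _.
  rewrite (normrM p') (normrM (1 - p')) (ger0_norm p'0) (ger0_norm p'1).
  rewrite [leRHS](_ : _ = p' * d w + (1 - p') * d w); last by ring.
  by apply: lerD; rewrite ler_wpM2l// fd.
rewrite normrM mulrA; apply: ler_pM => //.
  by rewrite mulrC e_sym cond_marginal_flip.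
have -> : f' true = f (upd (upd s v false) v (~~ upd s v false v)).
  by rewrite upd_upd updE eqxx.
exact: fd.
Qed.

Lemma glauber_op_osc f d :
  osc_le f d -> osc_le (glauber_op f) (influence_step d).
Proof.
move=> fd s w; rewrite !glauber_opE -mulrBr normrM ger0_norm ?invr_ge0//.
rewrite /influence_step ler_wpM2l ?invr_ge0// -sumrB.
apply: le_trans (ler_norm_sum _ _ _) _.
apply: (le_trans (ler_sum _ (fun v _ => site_op_osc v f d s w fd))).
rewrite big_split /= -mulr_suml -mulr_sumr lerD2r ler_wpM2r ?(osc_le_ge0 fd)//.
rewrite (bigD1 w)//= eqxx add0r.
rewrite (eq_bigr (fun=> 1)); last by move=> v vw; rewrite eq_sym vw.
by rewrite sumr_const lerBrDr natr1 ler_nat -(cardC (pred1 w)) card1 add1n.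
Qed.

(** Adding the terms at s and at its flip at v turns mu s into the mass of the
pair, on which resampling reproduces the conditional law of mu. *)
Lemma site_op_stationary v f :
  \sum_s mu s * site_op v f s = \sum_s mu s * f s.
Proof.
have flipE (g : config V -> R) : \sum_s g (flip s v) = \sum_s g s.
  by rewrite [RHS](reindex_inj (inv_inj (flipK v))).
suff H : (\sum_s mu s * site_op v f s) *+ 2 = (\sum_s mu s * f s) *+ 2.
  exact: (@pmulrnI R 2).
rewrite !mulr2n -{2}(flipE (fun s => mu s * site_op v f s)).
rewrite -{2}(flipE (fun s => mu s * f s)) -!big_split /=; apply: eq_bigr => s _.
have -> : site_op v f (flip s v) = site_op v f s.
  by apply: eq_bigr => b _; rewrite upd_flip cond_marginal_upd.
rewrite -mulrDl -(sum_upd mu) -(sum_upd (fun t => mu t * f t)) mulr_sumr.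
apply: eq_bigr => b _; rewrite mulrA; congr (_ * _).
by rewrite mulrC cond_marginal_balance.
Qed.

Hypothesis V_gt0 : (0 < #|V|)%N.

Lemma glauber_op_stationary f :
  \sum_s mu s * glauber_op f s = \sum_s mu s * f s.
Proof.
under eq_bigr do rewrite glauber_opE mulrCA mulr_sumr.
rewrite -mulr_sumr exchange_big /=.
under eq_bigr do rewrite site_op_stationary.
by rewrite sumr_const -[X in _ * X]mulr_natl mulKf// pnatr_eq0 -lt0n.
Qed.

Lemma mc_law_glauber t f s :
  \sum_y mc_law (glauber e mu) t s y * f y = iter t glauber_op f s.
Proof.
elim: t s => [|t IHt] s.
  rewrite (bigD1 s)//= /mc_law expr0 mxE eqxx mul1r big1 ?addr0// => y ys.
  by rewrite mxE (inj_eq enum_rank_inj) eq_sym (negbTE ys) mul0r.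
rewrite iterS /glauber_op -/(glauber_op).
under [RHS]eq_bigr do rewrite -IHt mulr_sumr.
rewrite exchange_big /=; apply: eq_bigr => y _.
rewrite /mc_law exprS mxE mulr_suml (reindex enum_rank) /=; last first.
  exact/onW_bij/enum_rank_bij.
by apply: eq_bigr => z _; rewrite mxE !enum_rankK mulrA.
Qed.

(** The total variation distance is half the integral, against the difference of
the two laws, of the sign f of that difference; f has oscillation at most 2. *)
Lemma tv_dist_glauber_le t (s : config V) :
  tv_dist (mc_law (glauber e mu) t s) mu
    <= 2^-1 * \sum_w iter t influence_step (fun=> 2) w.
Proof.
rewrite /tv_dist ler_wpM2l ?invr_ge0//.
pose f y := Num.sg (mc_law (glauber e mu) t s y - mu y).
have sg2 y y' : `|f y - f y'| <= 2.
  rewrite (le_trans (ler_normB _ _))// [leRHS](_ : 2 = 1 + 1)// lerD// normr_sg;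
  by case: (_ != 0).
have osc k : osc_le (iter k glauber_op f) (iter k influence_step (fun=> 2)).
  by elim: k => [s' w|k IHk]; [exact: sg2|exact: glauber_op_osc].
have stat k : \sum_y mu y * iter k glauber_op f y = \sum_y mu y * f y.
  by elim: k => // k IHk; rewrite iterS glauber_op_stationary.
under eq_bigr do rewrite normrEsg mulrC mulrBl -/(f _).
rewrite sumrB mc_law_glauber -(stat t).
apply: le_trans (ler_norm _) _; apply: osc_le_mean => //.
  by move=> y; rewrite ltW// ising_gt0.
exact: sum_ising.
Qed.

End Glauber.

(** * Contraction in the Euclidean norm *)

Lemma sum_enum_val {R : realType} {T : finType} (F : T -> R) :
  \sum_(i < #|T|) F (enum_val i) = \sum_x F x.
Proof.
rewrite (reindex enum_rank) /=; last exact/onW_bij/enum_rank_bij.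
by apply: eq_bigr => x _; rewrite enum_rankK.
Qed.

Lemma adjacency_l2_le {R : realType} {V : finType} (e : rel V) (d : V -> R) :
  symmetric e ->
  \sum_w (\sum_v (e w v)%:R * d v) ^+ 2
    <= spectral_radius (adjacency_mx R e) ^+ 2 * \sum_w d w ^+ 2.
Proof.
move=> e_sym; pose x : 'rV[R]_#|V| := \row_i d (enum_val i).
have symA : (adjacency_mx R e)^T = adjacency_mx R e.
  by apply/matrixP => i j; rewrite !mxE e_sym.
have xA i : (x *m adjacency_mx R e) 0 i = \sum_v (e (enum_val i) v)%:R * d v.
  rewrite mxE -[RHS]sum_enum_val; apply: eq_bigr => j _.
  by rewrite !mxE mulrC e_sym.
have := symmetric_mulmx_le _ x symA.
under eq_bigr do rewrite xA.
under [in leRHS]eq_bigr do rewrite mxE.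
by rewrite (sum_enum_val (fun w => (\sum_v (e w v)%:R * d v) ^+ 2))
  (sum_enum_val (fun w => d w ^+ 2)).
Qed.

(** Expand the square of (n - 1) d + a A d, using that A has norm at most rho;
the bound for the cross term comes from the square of rho d - A d. *)
Lemma influence_step_l2 {R : realType} {V : finType} (e : rel V)
    (beta delta : R) (d : V -> R) :
  let rho := spectral_radius (adjacency_mx R e) in
  symmetric e -> (0 < #|V|)%N -> 0 < rho -> 0 <= edge_influence beta ->
  edge_influence beta * rho <= 1 - delta ->
  \sum_w influence_step (e := e) (beta := beta) d w ^+ 2
    <= (1 - delta / #|V|%:R) ^+ 2 * \sum_w d w ^+ 2.
Proof.
move=> rho e_sym V0 rho0; rewrite /influence_step.
move: (edge_influence beta) => a a0 arho.
pose A w := \sum_v (e w v)%:R * d v.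
set n : R := #|V|%:R; set D := \sum_w d w ^+ 2.
have n1 : 1 <= n by rewrite ler1n.
pose X := \sum_w d w * A w; pose Y := \sum_w A w ^+ 2.
have YD : Y <= rho ^+ 2 * D by exact: adjacency_l2_le.
have D0 : 0 <= D by apply: sumr_ge0 => w _; exact: sqr_ge0.
have comb b c : \sum_w (b * d w + c * A w) ^+ 2
    = b ^+ 2 * D + 2 * b * c * X + c ^+ 2 * Y.
  rewrite !mulr_sumr -!big_split /=; apply: eq_bigr => w _; ring.
have XD : X <= rho * D.
  have : 0 <= \sum_w (rho * d w + (- 1) * A w) ^+ 2.
    by apply: sumr_ge0 => w _; exact: sqr_ge0.
  rewrite comb => H; rewrite -(ler_pM2l rho0); nra.
under eq_bigr do rewrite exprMn.
rewrite -mulr_sumr comb.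
have -> : 1 - delta / n = n^-1 * (n - delta)
  by field; rewrite gt_eqF// (lt_le_trans ltr01).
rewrite [(n^-1 * _) ^+ 2]exprMn -[leRHS]mulrA ler_wpM2l ?sqr_ge0//.
apply: (@le_trans _ _ ((n - 1 + a * rho) ^+ 2 * D)).
  rewrite [leRHS](_ : _ = (n - 1) ^+ 2 * D + 2 * (n - 1) * a * (rho * D)
                          + a ^+ 2 * (rho ^+ 2 * D)); last by ring.
  apply: lerD; last by rewrite ler_wpM2l ?sqr_ge0.
  by rewrite lerD2l ler_wpM2l// !mulr_ge0// subr_ge0.
rewrite ler_wpM2r// ler_sqr ?nnegrE; try lra.
  by rewrite addr_ge0 ?subr_ge0// mulr_ge0// ltW.
have : 0 <= a * rho by rewrite mulr_ge0// ltW.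
lra.
Qed.

(** Cauchy-Schwarz against the constant function, through the variance. *)
Lemma sum_le_l2 {R : realType} {T : finType} (d : T -> R) :
  (\sum_w d w) ^+ 2 <= #|T|%:R * \sum_w d w ^+ 2.
Proof.
set n : R := #|T|%:R; set S := \sum_w d w; set D := \sum_w d w ^+ 2.
have n0 : 0 <= n by [].
have H m : 0 <= D - 2 * m * S + m ^+ 2 * n.
  have -> : D - 2 * m * S + m ^+ 2 * n = \sum_w (d w - m) ^+ 2.
    rewrite /n -sumr_const !mulr_sumr -sumrB -big_split /=.
    by apply: eq_bigr => w _; ring.
  by apply: sumr_ge0 => w _; exact: sqr_ge0.
have [/eqP|n_neq0] := eqVneq n 0.
  rewrite pnatr_eq0 => /eqP/card0_eq T0.
  have -> : S = 0 by apply: big1 => w _; have := T0 w; rewrite inE.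
  by rewrite expr0n mulr_ge0// sumr_ge0// => w _; exact: sqr_ge0.
have n_gt0 : 0 < n by rewrite lt_def n_neq0.
(* The mean minimises the quadratic form in m. *)
have := H (S / n).
rewrite (_ : _ + _ = (n * D - S ^+ 2) / n); last by field.
by rewrite pmulr_lge0 ?invr_gt0// subr_ge0.
Qed.

Lemma sum_iter_influence_step {R : realType} {V : finType} (e : rel V)
    (beta delta : R) (t : nat) :
  let rho := spectral_radius (adjacency_mx R e) in
  symmetric e -> (0 < #|V|)%N -> 0 < rho -> 0 <= edge_influence beta ->
  edge_influence beta * rho <= 1 - delta ->
  \sum_w iter t (influence_step (e := e) (beta := beta)) (fun=> 2) w
    <= 2 * #|V|%:R * (1 - delta / #|V|%:R) ^+ t.
Proof.
move=> rho e_sym V0 rho0 a0 arho.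
set n : R := #|V|%:R; pose q := 1 - delta / n.
have n1 : 1 <= n by rewrite ler1n.
have q0 : 0 <= q.
  have : 0 <= edge_influence beta * rho by rewrite mulr_ge0// ltW.
  rewrite subr_ge0 ler_pdivrMr ?(lt_le_trans ltr01)//; lra.
have l2 : \sum_w iter t (influence_step (e := e) (beta := beta)) (fun=> 2) w ^+ 2
    <= (q ^+ t) ^+ 2 * (4 * n).
  elim: t => [|t IHt].
    by rewrite /= sumr_const expr0 expr1n mul1r mulr_natr -natrX.
  rewrite (exprS q) exprMn -mulrA.
  apply: (le_trans (influence_step_l2 _ _ _ _ e_sym V0 rho0 a0 arho)).
  by rewrite ler_wpM2l ?sqr_ge0.
rewrite -/q (le_trans (ler_norm _))//.
rewrite -ler_sqr ?nnegrE ?mulr_ge0 ?exprn_ge0// real_normK ?num_real//.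
apply: le_trans (sum_le_l2 _) _.
apply: (le_trans (ler_wpM2l _ l2)) => //.
by rewrite le_eqVlt; apply/orP; left; apply/eqP; rewrite -/n; ring.
Qed.

(** * From the contraction to the mixing time *)

Lemma edge_influence_le {R : realType} (rho delta beta : R) :
  2 <= rho -> 0 < delta < 1 -> 0 < beta ->
  (rho - 1 + delta) / (rho + 1 - delta) <= beta
     <= (rho + 1 - delta) / (rho - 1 + delta) ->
  edge_influence beta * rho <= 1 - delta.
Proof.
move=> rho2 /andP[d0 d1] b0 /andP[].
rewrite ler_pdivrMr; last by lra.
rewrite ler_pdivlMr; last by lra.
move=> lo hi; rewrite /edge_influence mulrAC ler_pdivrMr; last by lra.
have [b1|b1] := lerP 0 (beta - 1).
  by rewrite ger0_norm//; lra.
by rewrite ltr0_norm//; lra.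
Qed.

Lemma spectral_radius_card_le1 {R : realType} {V : finType} {e : rel V} :
  irreflexive e -> (#|V| <= 1)%N -> spectral_radius (adjacency_mx R e) = 0.
Proof.
move=> e_irr V1; rewrite /spectral_radius; set S := (X in sup X).
have /subset_set1[->|->] : (S `<=` [set 0])%classic; rewrite ?sup0 ?sup1//.
move=> _ [a /= + <-]; rewrite (_ : adjacency_mx R e = 0).
  rewrite map_mx0 => /eigenvalueP[v /esym/eqP]; rewrite mulmx0 scaler_eq0.
  by case/orP=> [/eqP-> _|->//]; rewrite ComplexField.Normc.normc0.
apply/matrixP => i j; rewrite !mxE.
by rewrite (fintype_le1P V1 (enum_val i) (enum_val j)) e_irr.
Qed.

Lemma geometric_decay_le {R : realType} (n delta : R) (t : nat) :
  0 < n -> 0 <= 1 - delta / n -> n / delta * ln (4 * n) <= t%:R -> 0 < delta ->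
  n * (1 - delta / n) ^+ t <= 4^-1.
Proof.
move=> n0 q0 tn d0.
have n4 : 0 < 4 * n by rewrite mulr_gt0.
rewrite -ler_pdivlMl//; apply: (@le_trans _ _ (expR (- (delta / n)) ^+ t)).
  by rewrite lerXn2r ?nnegrE ?expR_ge0// expR_ge1Dx.
rewrite -expRM_natl -invfM [n * 4]mulrC -[in leRHS](lnK (x := 4 * n)) ?posrE//.
rewrite -expRN ler_expR mulrN lerN2.
rewrite -(ler_pM2l (_ : 0 < n / delta)) ?divr_gt0//.
apply: (le_trans tn); rewrite le_eqVlt; apply/orP; left; apply/eqP.
by field; rewrite !gt_eqF.
Qed.

Theorem theorem2p1 (R : realType) (delta rhobar : R)
    (hdelta : 0 < delta < 1) (hrhobar : 2 <= rhobar) :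
  exists2 C : R, 0 < C &
    forall (V : finType) (e : rel V) (beta : R),
      connected_simple_graph e ->
      let n := #|V| in
      let rho := spectral_radius (adjacency_mx R e) in
      2 <= rho <= rhobar ->
      0 < beta ->
      (rho - 1 + delta) / (rho + 1 - delta) <= beta
        <= (rho + 1 - delta) / (rho - 1 + delta) ->
      let mu := ising e beta in
      (mixing_time (glauber e mu) mu <= (C * n%:R * ln n%:R)%:E)%E.
Proof.
have /andP[d0 d1] := hdelta.
have ln2 : 0 < ln (2 : R) by rewrite ln_gt0// ltr1n.
exists (3 / delta + (ln 2)^-1); first by rewrite addr_gt0 ?divr_gt0 ?invr_gt0.
move=> V e beta [e_sym e_irr _] n rho /andP[rho2 _] beta0 hbeta.
lazy zeta; set mu := ising e beta.
have n2 : (2 <= n)%N.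
  rewrite leqNgt; apply/negP; rewrite ltnS.
  move=> /(spectral_radius_card_le1 (R := R) e_irr) rho0.
  by move: rho2; rewrite /rho rho0 lern0.
have nR2 : 2 <= n%:R :> R by rewrite ler_nat.
have nR0 : 0 < n%:R :> R by lra.
(* ln 2 <= ln n absorbs the rounding up of the time to an integer. *)
have lnn : ln 2 <= ln (n%:R : R) by rewrite ler_ln ?posrE.
have ln4n0 : 0 <= ln (4 * n%:R : R) by rewrite ln_ge0//; lra.
pose x : R := n%:R / delta * ln (4 * n%:R).
have x0 : 0 <= x by rewrite mulr_ge0 ?divr_ge0 // ltW.
pose t := (Num.truncn x).+1.
have /andP[tx xt] := truncn_itv x0.
have a0 : 0 <= edge_influence beta by rewrite divr_ge0 //; lra.
have arho := edge_influence_le _ _ _ rho2 hdelta beta0 hbeta.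
have rho0 : 0 < rho by lra.
have V0 : (0 < #|V|)%N by exact: leq_trans n2.
have mixed : mixed_at (glauber e mu) mu t.
  move=> s _.
  apply: (le_trans (tv_dist_glauber_le e_sym e_irr beta0 V0 t s)).
  have := sum_iter_influence_step _ _ _ t e_sym V0 rho0 a0 arho.
  have : n%:R * (1 - delta / n%:R) ^+ t <= 4^-1.
    apply: geometric_decay_le => //; last exact: ltW.
    by rewrite subr_ge0 ler_pdivrMr//; lra.
  rewrite -/n; lra.
apply: ge_ereal_inf; exists (t%:R%:E) => /=; first by exists t.
rewrite lee_fin /t -[leLHS]natr1.
(* 4 n <= n^3 since n >= 2. *)
have ln4n : ln (4 * n%:R : R) <= 3 * ln n%:R.
  rewrite [leRHS]mulr_natl -lnXn// ler_ln ?posrE ?mulr_gt0 ?exprn_gt0//.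
  rewrite exprSr ler_wpM2r//; nra.
rewrite -mulrA mulrDl; apply: lerD.
  apply: (le_trans tx); rewrite /x.
  rewrite [leRHS](_ : _ = n%:R / delta * (3 * ln n%:R)); last first.
    by field; rewrite gt_eqF.
  by rewrite ler_wpM2l// divr_ge0 ?ltW.
rewrite mulrC ler_pdivlMr// mul1r; nra.
Qed.
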